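(* Let $f:[0,+\infty)\to[0,+\infty)$ be an integrable, decreasing, log-concave function with $\int_0^{+\infty} f(t)\,dt>0$. If $h>0$ is such that $$\int_0^h f(t)\,dt\leq (1-e^{-\sqrt3})\int_0^{+\infty}f(t)\,dt,$$ then $$\int_0^{+\infty}t^2f(t)\,dt\leq \frac{2h^2}{\left[-\log\left(1-\frac{\int_0^hf(t)\,dt}{\int_0^{+\infty}f(t)\,dt}\right)\right]^2}\int_0^{+\infty}f(t)\,dt.$$ Equality holds for $f(t)=ce^{-\lambda t}\chi_{[0,+\infty)}(t)$, with $c>0$ and $\lambda>0$.
   Context: ''Decreasing'' means non-increasing. A function $f:[0,+\infty)\to[0,+\infty)$ is log-concave if $f((1-\tau)x+\tau y)\geq f(x)^{1-\tau}f(y)^{\tau}$ for all $x,y\geq 0$ and $\tau\in(0,1)$. $\chi_A$ denotes the indicator function of $A$. Integrability is with respect to Lebesgue measure. *)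

(* Defs.v *)
From HB Require Import structures.
From mathcomp Require Import all_boot all_order all_algebra.
From mathcomp Require Import all_classical all_reals all_analysis.

Set Implicit Arguments.
Unset Strict Implicit.
Unset Printing Implicit Defensive.

Import Order.TTheory GRing.Theory Num.Theory.
Import numFieldNormedType.Exports.

Local Open Scope classical_set_scope.
Local Open Scope ring_scope.

(* A function [0,+oo) -> [0,+oo) is represented by f : R -> R; only its values
   on [0,+oo) are ever constrained or used. *)

Definition nonneg_on_halfline (R : realType) (f : R -> R) : Prop :=
  forall x : R, 0 <= x -> 0 <= f x.

(* "decreasing" in the weak sense, i.e. non-increasing *)
Definition decreasing_on_halfline (R : realType) (f : R -> R) : Prop :=
  forall x y : R, 0 <= x -> x <= y -> f y <= f x.

Definition log_concave_on_halfline (R : realType) (f : R -> R) : Prop :=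
  forall x y tau : R, 0 <= x -> 0 <= y -> 0 < tau -> tau < 1 ->
    f x `^ (1 - tau) * f y `^ tau <= f ((1 - tau) * x + tau * y).

Definition integrable_on_halfline (R : realType) (f : R -> R) : Prop :=
  (@lebesgue_measure R).-integrable `[0, +oo[ (EFin \o f).

(* Real-valued integrals (Rintegral is 0 when the integral is infinite), used
   only for f integrable on [0,+oo). *)
Definition total_mass (R : realType) (f : R -> R) : R :=
  \int[@lebesgue_measure R]_(t in `[0, +oo[) f t.

Definition mass_upto (R : realType) (f : R -> R) (h : R) : R :=
  \int[@lebesgue_measure R]_(t in `[0, h]) f t.

(* Extended-real-valued, so that an upper bound by a real number includes the
   finiteness of the second moment. *)
Definition second_moment (R : realType) (f : R -> R) : \bar R :=
  (\int[@lebesgue_measure R]_(t in `[0%R, +oo[) (t ^+ 2 * f t)%:E)%E.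

Definition admissible (R : realType) (f : R -> R) : Prop :=
  [/\ nonneg_on_halfline f, integrable_on_halfline f,
      decreasing_on_halfline f, log_concave_on_halfline f
    & 0 < total_mass f].

Definition small_mass_upto (R : realType) (f : R -> R) (h : R) : Prop :=
  mass_upto f h <= (1 - expR (- Num.sqrt 3)) * total_mass f.

Definition moment_bound (R : realType) (f : R -> R) (h : R) : R :=
  2 * h ^+ 2 / (- ln (1 - mass_upto f h / total_mass f)) ^+ 2 * total_mass f.

(* Main.v *)
Require Import Defs.
From HB Require Import structures.
From mathcomp Require Import all_boot all_order all_algebra.
From mathcomp Require Import all_classical all_reals all_analysis.
From mathcomp Require Import measurable_realfun.
From mathcomp Require Import ring lra.

(** Write [F] for the total mass of [f], [B] for its mass beyond [h], and
    [L = ln (F / B)]; the claim is that the second moment is at most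
    [2 F (h / L)^2], and the hypothesis on [h] says that [L <= sqrt 3].

    Among nonincreasing log-concave functions with prescribed masses on [[0, h]]
    and beyond [h], and prescribed value [m = f h], the second moment is largest
    for a plateau on [[0, a]] followed by an exponential of rate [s = m / B].
    The exponential through [(h, m)] of this rate has mass [B] beyond [h] and,
    by log-concavity, dominates [f] on [[0, h]] ([log_concave_le_exp_left]).
    Cutting it off at a suitable height produces a plateau function [g] with the
    same masses as [f] on both sides of [h]; the height exists by the
    intermediate value theorem ([exists_plateau_length]), because the uncut
    exponential has too much mass while the constant [m] has too little.  On
    each side of [h] the difference [f - g] passes at most once from positive
    to negative, and equal masses then order the second moments
    ([second_moment_le_of_crossing], [second_moment_le_plateau]).

    The moments of [g] are explicit.  With [x = s a] and [y = s h] the masses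
    give [L = ln (1 + x) + y - x], and the claim for [g] becomes
    [L^2 (1 + x + x^2/2 + x^3/6) <= (1 + x) y^2].  This real inequality is
    where [L <= sqrt 3] enters ([moment_inequality]).  A pure exponential is the
    case [x = 0], in which it is an equality. *)

Set Implicit Arguments.
Unset Strict Implicit.
Unset Printing Implicit Defensive.

Import Order.TTheory GRing.Theory Num.Theory.
Import numFieldNormedType.Exports.

Local Open Scope classical_set_scope.
Local Open Scope ring_scope.

(** * The inequality for the plateau parameters *)

(** The right-hand side is the Pade approximant of type [2/1] of [ln (1 + x)]:
    it agrees with it to third order at [0], and the derivative of the
    difference is [4 x^3 / ((6 + 4 x)^2 (1 + x))]. *)
Lemma ln1Dx_le (R : realType) (x : R) : 0 <= x ->
  ln (1 + x) <= x * (6 + x) / (6 + 4 * x).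
Proof.
move=> x0.
pose den : R -> R := cst 6 + 4 \*: id.
pose g : R -> R :=
  (id * (cst 6 + id)) * (fun t => (den t)^-1) - (@ln R \o (cst 1 + id)).
have dg (t : R) : 0 <= t ->
    is_derive t 1 g (4 * t ^+ 3 / ((6 + 4 * t) ^+ 2 * (1 + t))).
  move=> t0.
  have t1 : 0 < 1 + t by lra.
  have t6 : den t != 0 by rewrite (_ : den t = 6 + 4 * t)//; apply/eqP; lra.
  have dln : is_derive (1 + t) 1 (@ln R) (1 + t)^-1 by exact: is_derive1_ln.
  have dVden := is_deriveV t6 (_ : is_derive t 1 den _).
  have dlnp : is_derive t 1 (@ln R \o (cst 1 + id)) ((1 + t)^-1 * (0 + 1)).
    exact: is_derive1_comp.
  apply: is_derive_eq.
  have t6' : 6 + 4 * t != 0 by exact: t6.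
  change (t * (6 + t) * (- (6 + 4 * t) ^- 2 * (0 + 4 * 1)) +
    (6 + 4 * t)^-1 * (t * (0 + 1) + (6 + t) * 1) - (1 + t)^-1 * (0 + 1) =
    4 * t ^+ 3 / ((6 + 4 * t) ^+ 2 * (1 + t))).
  by field; rewrite t6' gt_eqF.
suff H : g 0 <= g x.
  have {}H : 0 * (6 + 0) * (6 + 4 * 0)^-1 - ln (1 + 0) <=
          x * (6 + x) * (6 + 4 * x)^-1 - ln (1 + x) by exact: H.
  by move: H; rewrite !mul0r addr0 ln1 subr0 subr_ge0.
have cg : {within `[0, x], continuous g}.
  apply: derivable_within_continuous => t; rewrite in_itv/= => /andP[t0 _].
  by have [] := dg t t0.
have dfg (t : R) : t \in `]0, x[ -> derivable g t 1.
  by rewrite in_itv/= => /andP[/ltW t0 _]; case: (dg t t0).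
have dge0 (t : R) : t \in `]0, x[ -> 0 <= g^`()%classic t.
  rewrite in_itv/= => /andP[/ltW t0 _].
  rewrite derive1E; have [_ ->] := dg t t0.
  by rewrite divr_ge0 ?mulr_ge0 ?exprn_ge0//; lra.
have mono := ger0_derive1_le_cc dfg dge0 cg.
by apply: (mono 0 x _ _ x0); rewrite in_itv/= ?lexx x0.
Qed.

(** The second-moment bound for a plateau of length [x / s] followed by an
    exponential tail of rate [s]; here [y = s h] and [L] is minus the logarithm
    of the tail fraction beyond [h].  With [d = 3 x^2 / (6 + 4 x)], a lower
    bound of [x - ln (1 + x)], one has [L + d <= y], and expanding
    [(1 + x) (L + d)^2] reduces the claim to
    [L^2 (x^2/2 + x^3/6) <= (1 + x) (2 L d + d^2)].  Divided by [L], the left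
    side is nondecreasing and the right side nonincreasing in [L], so that only
    [L = sqrt 3] matters; there, clearing denominators leaves a polynomial with
    nonnegative coefficients. *)
Lemma moment_inequality (R : realType) (x L y : R) : 0 <= x ->
  L = ln (1 + x) + y - x -> 0 <= L -> L <= Num.sqrt 3 ->
  L ^+ 2 * (1 + x + x ^+ 2 / 2 + x ^+ 3 / 6) <= (1 + x) * y ^+ 2.
Proof.
move=> x0 LE L0 L3.
have x1 : 0 < 1 + x by lra.
have x6 : 0 < 6 + 4 * x by lra.
pose d := 3 * x ^+ 2 / (6 + 4 * x).
have d0 : 0 <= d by rewrite /d divr_ge0 ?mulr_ge0 ?exprn_ge0//; lra.
have yE : L + d <= y.
  have := ln1Dx_le x0; suff -> : x * (6 + x) / (6 + 4 * x) = x - d by lra.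
  by rewrite /d; field; apply/eqP; lra.
have s0 : 0 <= Num.sqrt 3 :> R by rewrite sqrtr_ge0.
have s2 : Num.sqrt 3 ^+ 2 = 3 :> R by rewrite sqr_sqrtr; lra.
have s17 : 17 / 10 <= Num.sqrt 3 :> R by nra.
set s : R := Num.sqrt 3 in s0 s2 s17 L3.
suff key : L ^+ 2 * (x ^+ 2 / 2 + x ^+ 3 / 6) <= (1 + x) * (2 * L * d + d ^+ 2).
  apply: (@le_trans _ _ ((1 + x) * (L + d) ^+ 2)); first by nra.
  by rewrite ler_pM2l// ler_pXn2r// nnegrE; lra.
pose Q := x ^+ 2 / 2 + x ^+ 3 / 6.
have Q0 : 0 <= Q by rewrite /Q addr_ge0// divr_ge0 ?exprn_ge0//; lra.
have ext : s ^+ 2 * Q <= (1 + x) * (2 * s * d + d ^+ 2).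
  have -> : s ^+ 2 * Q = 3 * x ^+ 2 * (3 + x) / 6 by rewrite s2 /Q; field.
  (* The margin allows replacing [sqrt 3] by [17/10]. *)
  have lhs : 3 * x ^+ 2 * (3 + x) / 6 <= (1 + x) * (2 * (17/10) * d + d ^+ 2).
    rewrite -subr_ge0.
    have -> : (1 + x) * (2 * (17/10) * d + d ^+ 2) - 3 * x ^+ 2 * (3 + x) / 6 =
      x ^+ 2 * (36 / 5 + 12 * x + 9/5 * x ^+ 2 + x ^+ 3) / (6 + 4 * x) ^+ 2.
      by rewrite /d; field; apply/eqP; lra.
    rewrite divr_ge0 ?sqr_ge0// mulr_ge0 ?sqr_ge0//.
    have := exprn_ge0 2 x0; have := exprn_ge0 3 x0; lra.
  by apply: (le_trans lhs); rewrite ler_pM2l// lerD2r ler_wpM2r//; lra.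
(* From [L = s] to all [0 <= L <= s]: divided by [L], the right-hand side is
   nonincreasing in [L] and the left-hand side nondecreasing. *)
have : L * (s ^+ 2 * Q) <= s * ((1 + x) * (2 * L * d + d ^+ 2)).
  apply: (le_trans (ler_wpM2l L0 ext)).
  suff : L * d ^+ 2 <= s * d ^+ 2 by nra.
  by rewrite ler_wpM2r ?exprn_ge0.
move=> H; have sp : 0 < s by lra.
rewrite -(ler_pM2l sp); apply: le_trans H; rewrite -/Q.
have -> : L * (s ^+ 2 * Q) = s * (L * s * Q) by ring.
by rewrite ler_wpM2l// ler_wpM2r// expr2 ler_wpM2l.
Qed.

Section halfline.
Context (R : realType).
Local Notation mu := (@lebesgue_measure R).

(** * Comparison of second moments *)

(** The quotient of a log-concave function by an exponential is log-concave, so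
    the set where it is at least [A] is an interval.  Strictness at the right
    end is what makes the lemma usable by contraposition. *)
Lemma log_concave_above_exp (f : R -> R) (A s x y z : R) :
  log_concave_on_halfline f -> 0 < A -> 0 <= x -> x < y -> y < z ->
  A * expR (- s * x) <= f x -> A * expR (- s * z) < f z ->
  A * expR (- s * y) < f y.
Proof.
move=> lc A0 x0 xy yz fx fz.
pose tau := (y - x) / (z - x).
have zx : 0 < z - x by lra.
have tau0 : 0 < tau by rewrite divr_gt0//; lra.
have tau1 : tau < 1 by rewrite ltr_pdivrMr//; lra.
have yE : y = (1 - tau) * x + tau * z by rewrite /tau; field; apply/eqP; lra.
have E0 u : 0 < A * expR (- s * u) by rewrite mulr_gt0// expR_gt0.
rewrite {2}yE.
apply: lt_le_trans (lc x z tau x0 _ tau0 tau1); last by lra.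
(* The exponential is log-linear: its value at [y] is the geometric mean of
   its values at [x] and [z]. *)
apply: (@le_lt_trans _ _ ((A * expR (- s * x)) `^ (1 - tau) *
                          (A * expR (- s * z)) `^ tau)).
  rewrite /powR !gt_eqF//= -expRD !lnM ?posrE ?expR_gt0// !expRK.
  rewrite -[A in leLHS](@lnK _ A) ?posrE// -expRD ler_expR {1}yE.
  by rewrite le_eqVlt; apply/orP; left; apply/eqP; ring.
apply: (@lt_le_trans _ _ ((A * expR (- s * x)) `^ (1 - tau) * (f z) `^ tau)).
  rewrite ltr_pM2l ?powR_gt0// gt0_ltr_powR// nnegrE ltW//.
  exact: lt_trans fz.
rewrite ler_wpM2r ?powR_ge0// ge0_ler_powR// ?nnegrE ?ltW//; first by lra.
exact: lt_le_trans fx.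
Qed.

Lemma ae_eq_of_le_integral_eq (D : set R) (f g : R -> R) :
  measurable D -> measurable_fun D f -> measurable_fun D g ->
  (forall t, D t -> 0 <= g t) -> (forall t, D t -> g t <= f t) ->
  (\int[mu]_(t in D) (f t)%:E = \int[mu]_(t in D) (g t)%:E)%E ->
  (\int[mu]_(t in D) (g t)%:E < +oo)%E ->
  ae_eq mu D f g.
Proof.
move=> mD mf mg g0 gf fgE gfin.
have f0 t : D t -> 0 <= f t by move=> Dt; exact: le_trans (g0 t Dt) (gf t Dt).
have fin_f : (\int[mu]_(t in D) (f t)%:E < +oo)%E by rewrite fgE.
have int_g : mu.-integrable D (EFin \o g).
  apply/integrableP; split; first exact/measurable_EFinP.
  under eq_integral => t /[!inE] Dt do rewrite /= ger0_norm ?g0//.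
  exact: gfin.
have int_f : mu.-integrable D (EFin \o f).
  apply/integrableP; split; first exact/measurable_EFinP.
  under eq_integral => t /[!inE] Dt do rewrite /= ger0_norm ?f0//.
  exact: fin_f.
have : (\int[mu]_(t in D) `|(f t)%:E - (g t)%:E| = 0)%E.
  under eq_integral => t /[!inE] Dt
    do rewrite gee0_abs ?sube_ge0// ?lee_fin ?gf//.
  rewrite integralB//= fgE subee// ge0_fin_numE//.
  by apply: integral_ge0 => t Dt; rewrite lee_fin g0.
move=> /ae_eq_integral_abs ae0.
have mfg : measurable_fun D (fun t => ((f t)%:E - (g t)%:E)%E).
  by apply: emeasurable_funB; exact/measurable_EFinP.
move: (ae0 mD mfg); apply: filterS => t /= H Dt.
by move: (H Dt); rewrite -EFinB => -[/eqP]; rewrite subr_eq0 => /eqP.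
Qed.

(** If [f - g] changes sign at most once, from positive to negative at [c], then
    [(t^2 - c^2) (f - g)] is nowhere positive on the half-line; integrating it
    with equal masses gives the comparison of second moments.  The crossing
    hypothesis says, without naming [c], that [g] is not above [f] to the left
    of a point where [f] exceeds [g].  The pointwise inequality is integrated in
    the subtraction-free form [t^2 f + c^2 g <= t^2 g + c^2 f], which is
    meaningful even when a second moment is infinite. *)
Lemma second_moment_le_of_crossing (D : set R) (f g : R -> R) :
  measurable D -> D `<=` `[0, +oo[ ->
  measurable_fun D f -> measurable_fun D g ->
  (forall t, D t -> 0 <= f t) -> (forall t, D t -> 0 <= g t) ->
  (\int[mu]_(t in D) (f t)%:E = \int[mu]_(t in D) (g t)%:E)%E ->
  (\int[mu]_(t in D) (g t)%:E < +oo)%E ->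
  (forall x y, D x -> D y -> x < y -> g y < f y -> g x <= f x) ->
  (\int[mu]_(t in D) (t ^+ 2 * f t)%:E <=
   \int[mu]_(t in D) (t ^+ 2 * g t)%:E)%E.
Proof.
move=> mD Dpos mf mg f0 g0 fgE gfin cross.
have D0 t : D t -> 0 <= t by move=> /Dpos; rewrite /= in_itv/= andbT.
have mid : measurable_fun D (fun t : R => t ^+ 2).
  exact: exprn_measurable.
have mf2 : measurable_fun D (fun t => t ^+ 2 * f t) by exact: measurable_funM.
have mg2 : measurable_fun D (fun t => t ^+ 2 * g t) by exact: measurable_funM.
pose U := [set t | D t /\ g t < f t].
have [[b Ub]|Uunbd] := pselect (has_ubound U); last first.
  (* The crossing is at infinity: [f] dominates [g] with the same mass, hence
     [f = g] almost everywhere. *)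
  have gf t : D t -> g t <= f t.
    move=> Dt; have [u [[Du gfu] tu]] : exists u, U u /\ t < u.
      apply: contrapT => H; apply: Uunbd; exists t => u Uu.
      by rewrite leNgt; apply/negP => tu; apply: H; exists u.
    exact: cross gfu.
  rewrite (@ge0_ae_eq_integral _ _ _ mu D _ (fun t => (t ^+ 2 * g t)%:E))//.
  - exact/measurable_EFinP.
  - exact/measurable_EFinP.
  - by move=> t Dt; rewrite lee_fin mulr_ge0 ?exprn_ge0 ?f0 ?(D0 _ Dt).
  - by move=> t Dt; rewrite lee_fin mulr_ge0 ?exprn_ge0 ?g0 ?(D0 _ Dt).
  - have := ae_eq_of_le_integral_eq mD mf mg g0 gf fgE gfin.
    by apply: filterS => t fg Dt; rewrite fg.
(* When [U] is empty, [f <= g] throughout and [c = 0] serves. *)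
pose c := if asbool (U !=set0) then sup U else 0.
have c0 : 0 <= c.
  rewrite /c; case: asboolP => // -[u Uu].
  apply: (@le_trans _ _ u); first by apply: D0; case: Uu.
  by apply: ub_le_sup => //; exists b.
have below t : D t -> t < c -> g t <= f t.
  rewrite /c; case: asboolP => [U0|_]; last first.
    by move=> /D0; rewrite leNgt => /negP.
  move=> Dt tc; have e0 : 0 < sup U - t by rewrite subr_gt0.
  have [|u [Du gfu]] := @sup_adherent _ U _ e0; first by split => //; exists b.
  by rewrite opprB addrC subrK => tu; exact: cross gfu.
have above t : D t -> c < t -> f t <= g t.
  rewrite /c => Dt; case: asboolP => [U0|U0] ct;
    rewrite leNgt; apply/negP => gft.
    have : t <= sup U by apply: ub_le_sup; [exists b|].
    by rewrite leNgt ct.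
  by apply: U0; exists t.
pose k := c ^+ 2.
have k0 : 0 <= k by rewrite exprn_ge0.
have pt t : D t -> t ^+ 2 * f t + k * g t <= t ^+ 2 * g t + k * f t.
  move=> Dt; rewrite -subr_ge0.
  have -> : t ^+ 2 * g t + k * f t - (t ^+ 2 * f t + k * g t) =
            (c + t) * ((c - t) * (f t - g t)) by rewrite /k; ring.
  rewrite mulr_ge0 ?addr_ge0 ?(D0 _ Dt)//.
  have [tc|ct|tc] := ltgtP t c; last by rewrite tc subrr mul0r.
    by rewrite mulr_ge0// subr_ge0 ?below// ltW.
  by rewrite mulr_le0// subr_le0 ?above// ltW.
have split (u v : R -> R) : measurable_fun D u -> measurable_fun D v ->
    (forall t, D t -> 0 <= u t) -> (forall t, D t -> 0 <= v t) ->
    (\int[mu]_(t in D) (t ^+ 2 * u t + k * v t)%:E =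
     \int[mu]_(t in D) (t ^+ 2 * u t)%:E + k%:E * \int[mu]_(t in D) (v t)%:E)%E.
  move=> mu_ mv u0 v0.
  under eq_integral do rewrite EFinD.
  rewrite ge0_integralD//.
  - congr (_ + _)%E; under eq_integral do rewrite EFinM.
    rewrite ge0_integralZl_EFin//; exact/measurable_EFinP.
  - by move=> t Dt; rewrite lee_fin mulr_ge0 ?exprn_ge0 ?(D0 _ Dt) ?u0.
  - by apply/measurable_EFinP; exact: measurable_funM.
  - by move=> t Dt; rewrite lee_fin mulr_ge0 ?v0.
  - apply/measurable_EFinP.
    by apply: measurable_funM => //; exact: measurable_cst.
have : (\int[mu]_(t in D) (t ^+ 2 * f t + k * g t)%:E <=
        \int[mu]_(t in D) (t ^+ 2 * g t + k * f t)%:E)%E.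
  apply: ge0_le_integral => //.
  - move=> t Dt.
    by rewrite lee_fin addr_ge0 ?mulr_ge0 ?exprn_ge0 ?f0 ?g0 ?(D0 _ Dt).
  - apply/measurable_EFinP; apply: measurable_funD => //.
    by apply: measurable_funM => //; exact: measurable_cst.
  - apply/measurable_EFinP; apply: measurable_funD => //.
    by apply: measurable_funM => //; exact: measurable_cst.
rewrite !split// fgE leeD2rE// fin_numM// ge0_fin_numE//.
by apply: integral_ge0 => t Dt; rewrite lee_fin g0.
Qed.

(** * Integrals of polynomials against exponentials *)

(** Termwise, the [i.+1]-st term of the exponential series gives
    [t^i exp(-s t) <= (i+1)! / (s^(i+1) t)]. *)
Lemma cvg_horner_expR0 (p : {poly R}) (s : R) : 0 < s ->
  p.[t] * expR (- s * t) @[t --> +oo] --> 0.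
Proof.
move=> s0.
have -> : (fun t => p.[t] * expR (- s * t)) =
          (fun t => \sum_(i < size p) p`_i * (t ^+ i * expR (- s * t))).
  apply/funext => t; rewrite horner_coef mulr_suml.
  by apply: eq_bigr => i _; rewrite mulrA.
rewrite [X in _ --> X](_ : 0 = \sum_(i < size p) p`_i * 0); last first.
  by rewrite big1// => i _; rewrite mulr0.
apply: cvg_big => [|i _]; first exact: add_continuous.
apply: cvgM; first exact: cvg_cst.
pose C := (i.+1)`!%:R / s ^+ i.+1.
apply: (@squeeze_cvgr _ _ _ _ (cst 0) (fun t => C * t^-1)).
- near=> t.
  have t0 : 0 < t by near: t; exact: nbhs_pinfty_gt.
  rewrite mulr_ge0 ?exprn_ge0 ?expR_ge0 ?(ltW t0)//=.
  rewrite mulNr expRN.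
  have := @expR_ge1Dxn R (s * t) i (mulr_ge0 (ltW s0) (ltW t0)) => H.
  have pw : 0 < (s * t) ^+ i.+1 / (i.+1)`!%:R.
    by rewrite divr_gt0 ?exprn_gt0 ?mulr_gt0// ltr0n fact_gt0.
  have {}H : (expR (s * t))^-1 <= ((s * t) ^+ i.+1 / (i.+1)`!%:R)^-1.
    rewrite lef_pV2 ?posrE ?expR_gt0//; apply: le_trans H; lra.
  apply: (le_trans (ler_wpM2l (exprn_ge0 _ (ltW t0)) H)).
  rewrite le_eqVlt; apply/orP; left; apply/eqP.
  rewrite /C exprMn (exprS t); field.
  by rewrite !gt_eqF ?exprn_gt0 ?ltr0n ?fact_gt0.
- exact: cvg_cst.
- rewrite -[X in _ --> X](mulr0 C); apply: cvgM; first exact: cvg_cst.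
  apply/gtr0_cvgV0; last exact: cvg_id.
  exact: nbhs_pinfty_gt.
Unshelve. all: by end_near. Qed.

(** [- p(t) exp(-s t)] is a primitive of [(s p - p')(t) exp(-s t)], so every
    polynomial moment of an exponential is read off from a [p] solving
    [s p - p' = q]. *)
Lemma integral_horner_expR (p q : {poly R}) (s b : R) : 0 < s ->
  q = s *: p - p^`() -> (forall t, b <= t -> 0 <= q.[t]) ->
  (\int[mu]_(t in `[b, +oo[) (q.[t] * expR (- s * t))%:E =
   (p.[b] * expR (- s * b))%:E)%E.
Proof.
move=> s0 qE q0.
pose F : R -> R := - (horner p * (expR \o (- s \*: id))).
have dF (t : R) : is_derive t 1 F (q.[t] * expR (- s * t)).
  apply: is_derive_eq.
  by rewrite qE !hornerE /GRing.scale /= ?fctE /GRing.scale /=; ring.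
have cF : continuous F.
  by move=> t; apply/differentiable_continuous/derivable1_diffP; case: (dF t).
rewrite (@ge0_continuous_FTC2y _ _ F _ 0).
- by rewrite /F EFinN oppeK add0e.
- by move=> t bt; rewrite mulr_ge0 ?expR_ge0 ?q0.
- apply: continuous_subspaceT => t.
  apply: cvgM; first exact: continuous_horner.
  apply: continuous_comp; last exact: continuous_expR.
  by apply: cvgM; [exact: cvg_cst|exact: cvg_id].
- by rewrite -oppr0; apply: cvgN; exact: cvg_horner_expR0.
- by move=> t _; case: (dF t).
- exact/cvg_at_right_filter/cF.
- by move=> t _; rewrite derive1E; case: (dF t).
Qed.

Lemma integral_exp_tail (K s b : R) : 0 <= K -> 0 < s ->
  (\int[mu]_(t in `[b, +oo[) (K * expR (- s * t))%:E =
   (K * expR (- s * b) / s)%:E)%E.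
Proof.
move=> K0 s0.
have := @integral_horner_expR (K / s)%:P K%:P s b s0.
under eq_integral do rewrite hornerE.
rewrite hornerE => ->.
- by congr EFin; ring.
- rewrite derivC subr0 -mul_polyC -polyCM; congr (_%:P).
  by field; rewrite gt_eqF.
- by move=> t _; rewrite hornerE.
Qed.

Lemma integral_sqr_exp_tail (K s b : R) : 0 <= K -> 0 < s ->
  (\int[mu]_(t in `[b, +oo[) (t ^+ 2 * (K * expR (- s * t)))%:E =
   (K * expR (- s * b) * (b ^+ 2 / s + 2 * b / s ^+ 2 + 2 / s ^+ 3))%:E)%E.
Proof.
move=> K0 s0.
pose p : {poly R} :=
  (K / s) *: 'X^2 + (2 * K / s ^+ 2) *: 'X + (2 * K / s ^+ 3)%:P.
have := @integral_horner_expR p (K *: 'X^2) s b s0.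
under eq_integral do rewrite hornerZ hornerXn -mulrA mulrCA.
move=> ->.
- rewrite /p !hornerE; congr EFin => /=; field; rewrite gt_eqF//.
- rewrite /p !poly.derivE -!mul_polyC; apply/polyP => i; rewrite !coefE.
  case: i => [|[|[|i]]] /=; rewrite ?mulr0 ?mulr1 ?addr0 ?subr0;
    try (field; rewrite gt_eqF//).
- by move=> t _; rewrite hornerZ hornerXn mulr_ge0// sqr_ge0.
Qed.

Lemma integral_sqr_itv (a : R) : 0 <= a ->
  (\int[mu]_(t in `[0%R, a]) (t ^+ 2)%:E = (a ^+ 3 / 3)%:E)%E.
Proof.
rewrite le_eqVlt => /predU1P[<-|a0].
  by rewrite set_itv1 integral_set1 expr0n mul0r.
pose F : R -> R := 3^-1 \*: (id ^+ 3).
have dF (t : R) : is_derive t 1 F (t ^+ 2).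
  by apply: is_derive_eq; rewrite /GRing.scale /= ?fctE /=; field.
have cF : continuous F.
  by move=> t; apply/differentiable_continuous/derivable1_diffP; case: (dF t).
rewrite (@continuous_FTC2 _ _ F)//.
- rewrite (_ : F a = 3^-1 * a ^+ 3)// (_ : F 0 = 3^-1 * 0 ^+ 3)//.
  by rewrite expr0n mulr0 sube0 mulrC.
- by apply: continuous_subspaceT => t; exact: exprn_continuous.
- split.
  + by move=> t _; case: (dF t).
  + exact/cvg_at_right_filter/cF.
  + exact/cvg_at_left_filter/cF.
- by move=> t _; rewrite derive1E; case: (dF t).
Qed.

(** * Exponentials cut off by a plateau *)

Lemma ge0_integral_halfline_split (b : R) (g : R -> R) : 0 <= b ->
  measurable_fun (`[0, +oo[ : set R) g -> (forall t, 0 <= t -> 0 <= g t) ->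
  (\int[mu]_(t in `[0%R, +oo[) (g t)%:E =
   \int[mu]_(t in `[0%R, b]) (g t)%:E + \int[mu]_(t in `]b, +oo[) (g t)%:E)%E.
Proof.
move=> b0 mg g0.
have E : `[0, +oo[%classic = (`[0, b] `|` `]b, +oo[)%classic :> set R.
  by rewrite -itv_bndbnd_setU// ?bnd_simp.
rewrite E ge0_integral_setU//=.
- by rewrite -E; exact/measurable_EFinP.
- move=> x; rewrite -[_ \/ _]/((`[0, b] `|` `]b, +oo[) x) -E /= in_itv/= andbT.
  by move=> /g0; rewrite lee_fin.
- apply/disj_setPS => x [] /=; rewrite !in_itv/= andbT => /andP[_ xb].
  by rewrite ltNge xb.
Qed.

(** [Num.max a t] makes this constant up to [a] and exponential from [a] on,
    continuously, without a case distinction in the definition. *)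
Definition plateau_exp (K s a t : R) : R := K * expR (- s * Num.max a t).

Lemma plateau_exp_ge0 (K s a t : R) : 0 <= K -> 0 <= plateau_exp K s a t.
Proof. by move=> K0; rewrite mulr_ge0 ?expR_ge0. Qed.

Lemma measurable_plateau_exp (K s a : R) (D : set R) :
  measurable_fun D (plateau_exp K s a).
Proof.
apply: measurable_funM; first exact: measurable_cst.
apply: measurableT_comp; first exact: measurable_expR.
apply: measurable_funM; first exact: measurable_cst.
by apply: measurable_maxr; [exact: measurable_cst|exact: measurable_id].
Qed.

Lemma plateau_expE_le (K s a t : R) :
  t <= a -> plateau_exp K s a t = K * expR (- s * a).
Proof. by move=> ta; rewrite /plateau_exp max_l. Qed.

Lemma plateau_expE_ge (K s a t : R) :
  a <= t -> plateau_exp K s a t = K * expR (- s * t).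
Proof. by move=> ta; rewrite /plateau_exp max_r. Qed.

Lemma integral_plateau_tail (K s a b : R) : 0 <= K -> 0 < s -> a <= b ->
  (\int[mu]_(t in `]b, +oo[) (plateau_exp K s a t)%:E =
   (K * expR (- s * b) / s)%:E)%E.
Proof.
move=> K0 s0 ab.
rewrite integral_itv_obnd_cbnd; last first.
  by apply/measurable_EFinP; exact: measurable_plateau_exp.
rewrite -(integral_exp_tail b K0 s0).
apply: eq_integral => t; rewrite inE /= in_itv/= andbT => bt.
by rewrite plateau_expE_ge// (le_trans ab).
Qed.

Lemma integral_plateau (K s a : R) : 0 <= K -> 0 < s -> 0 <= a ->
  (\int[mu]_(t in `[0%R, +oo[) (plateau_exp K s a t)%:E =
   (K * expR (- s * a) * (a + 1 / s))%:E)%E.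
Proof.
move=> K0 s0 a0.
rewrite (ge0_integral_halfline_split a0); last 2 first.
- exact: measurable_plateau_exp.
- by move=> t _; exact: plateau_exp_ge0.
rewrite integral_plateau_tail//.
rewrite (@eq_integral _ _ _ _ _ (cst (K * expR (- s * a))%:E)).
  rewrite integral_cst//= lebesgue_measure_itv/= lte_fin.
  case: ifPn => [_|]; last rewrite -leNgt => a0'.
    by rewrite sube0 -EFinM -EFinD; congr EFin; field; rewrite gt_eqF.
  have -> : a = 0 by apply/le_anti; rewrite a0 a0'.
  by rewrite mule0 add0e add0r mul1r.
by move=> t; rewrite inE /= in_itv/= => /andP[_ ta]; rewrite plateau_expE_le.
Qed.

Lemma integral_sqr_plateau (K s a : R) : 0 <= K -> 0 < s -> 0 <= a ->
  (\int[mu]_(t in `[0%R, +oo[) (t ^+ 2 * plateau_exp K s a t)%:E =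
   (K * expR (- s * a) *
    (a ^+ 3 / 3 + a ^+ 2 / s + 2 * a / s ^+ 2 + 2 / s ^+ 3))%:E)%E.
Proof.
move=> K0 s0 a0.
have mt2 (D : set R) : measurable_fun D (fun t => t ^+ 2 * plateau_exp K s a t).
  by apply: measurable_funM => //; exact: measurable_plateau_exp.
rewrite (ge0_integral_halfline_split a0)//; last first.
  by move=> t _; rewrite mulr_ge0 ?sqr_ge0 ?plateau_exp_ge0.
rewrite [X in (X + _)%E](_ : _ = (K * expR (- s * a) * (a ^+ 3 / 3))%:E).
  rewrite [X in (_ + X)%E](_ : _ = (K * expR (- s * a) *
      (a ^+ 2 / s + 2 * a / s ^+ 2 + 2 / s ^+ 3))%:E).
    by rewrite -EFinD; congr EFin; ring.
  rewrite integral_itv_obnd_cbnd; last exact/measurable_EFinP.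
  rewrite -integral_sqr_exp_tail//.
  apply: eq_integral => t; rewrite inE /= in_itv/= andbT => bt.
  by rewrite plateau_expE_ge.
rewrite EFinM -(integral_sqr_itv a0) -ge0_integralZl_EFin//.
- apply: eq_integral => t; rewrite inE /= in_itv/= => /andP[_ ta].
  by rewrite plateau_expE_le// mulrC EFinM.
- by move=> t _; rewrite lee_fin sqr_ge0.
- exact/measurable_EFinP.
- by rewrite mulr_ge0 ?expR_ge0.
Qed.

(** * The bound *)

(** The exponential through [(h, f h)] with rate [f h / B] has the same mass [B]
    beyond [h] as [f].  Were [f] above it at some [t < h], the exponential
    through [(t, f t)] and [(h, f h)] would be strictly steeper, would dominate
    [f] beyond [h] by log-concavity, and would have mass less than [B] there. *)
Lemma log_concave_le_exp_left (f : R -> R) (h B t : R) :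
  nonneg_on_halfline f -> log_concave_on_halfline f ->
  measurable_fun (`[0, +oo[ : set R) f -> 0 < f h ->
  (\int[mu]_(u in `]h, +oo[) (f u)%:E = B%:E)%E -> 0 < B ->
  0 <= t -> t <= h ->
  f t <= f h * expR (f h / B * h) * expR (- (f h / B) * t).
Proof.
move=> f0 lc mf fh IB B0 t0.
rewrite le_eqVlt => /predU1P[->|th].
  by rewrite -mulrA -expRD mulNr subrr expR0 mulr1.
rewrite leNgt; apply/negP => big.
set s := f h / B in big.
have ft : 0 < f t by apply: lt_trans big; rewrite !mulr_gt0 ?expR_gt0.
have ht : 0 < h - t by rewrite subr_gt0.
pose r := ln (f t / f h) / (h - t).
pose A := f h * expR (r * h).
have Ah : A * expR (- r * h) = f h.
  by rewrite /A -mulrA -expRD mulNr subrr expR0 mulr1.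
have At : A * expR (- r * t) = f t.
  rewrite /A -mulrA -expRD.
  have -> : r * h + - r * t = ln (f t / f h).
    by rewrite /r; field; rewrite gt_eqF.
  by rewrite lnK ?posrE ?divr_gt0//; field; rewrite gt_eqF.
have sr : s < r.
  rewrite /r ltr_pdivlMr// -ltr_expR lnK ?posrE ?divr_gt0//.
  rewrite ltr_pdivlMr//; apply: le_lt_trans big.
  rewrite -mulrA -expRD mulrC ler_pM2l// ler_expR.
  by rewrite le_eqVlt; apply/orP; left; apply/eqP; ring.
have s0 : 0 < s by rewrite divr_gt0.
have r0 : 0 < r by exact: lt_trans sr.
have A0 : 0 < A by rewrite mulr_gt0 ?expR_gt0.
have h0 : 0 <= h by exact/ltW/(le_lt_trans t0).
have fu u : h < u -> f u <= A * expR (- r * u).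
  move=> hu; rewrite leNgt; apply/negP => fu.
  have := log_concave_above_exp lc A0 t0 th hu _ fu.
  by rewrite At Ah ltxx lexx => /(_ isT).
have : (B%:E <= (f h / r)%:E)%E.
  rewrite -IB -Ah -(@integral_plateau_tail A r h) ?(ltW A0)//.
  apply: ge0_le_integral => //.
  - move=> u; rewrite /= in_itv/= andbT => hu.
    by rewrite lee_fin f0// ltW// (le_lt_trans h0).
  - apply/measurable_EFinP; apply: measurable_funS mf => //.
    by apply: subset_itvr; rewrite bnd_simp.
  - apply/measurable_EFinP; exact: measurable_plateau_exp.
  - move=> u; rewrite /= in_itv/= andbT => hu.
    by rewrite lee_fin plateau_expE_ge ?fu// ltW.
rewrite lee_fin leNgt => /negP; apply.
by rewrite ltr_pdivrMr// mulrC -ltr_pdivrMr.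
Qed.

(** For an exponential of rate [s] cut off at [x / s], the total mass divided by
    the mass beyond [y / s] is [(1 + x) exp(y - x)]; it ranges from [exp y] (no
    cut) down to [1 + y] (cut at [y / s]). *)
Lemma exists_plateau_length (y v : R) : 0 <= y -> 1 + y <= v -> v <= expR y ->
  exists2 x, 0 <= x <= y & (1 + x) * expR (y - x) = v.
Proof.
move=> y0 yv vy.
pose phi (x : R) := (1 + x) * expR (y - x).
have cphi : {within `[0, y], continuous phi}.
  apply: continuous_subspaceT => t; apply: cvgM.
    by apply: cvgD; [exact: cvg_cst|exact: cvg_id].
  apply: continuous_comp; last exact: continuous_expR.
  by apply: cvgB; [exact: cvg_cst|exact: cvg_id].
have phi0 : phi 0 = expR y by rewrite /phi addr0 subr0 mul1r.
have phiy : phi y = 1 + y by rewrite /phi subrr expR0 mulr1.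
have [|x] := @IVT _ phi 0 y v y0 cphi.
  by rewrite phi0 phiy ge_min le_max yv vy orbT.
by rewrite in_itv/= => xy xE; exists x.
Qed.

(** The two comparisons, below and beyond [h].  On [[0, h]] the plateau is
    crossed downwards since [f] is nonincreasing, and past [a] the exponential
    dominates [f].  Beyond [h] the quotient of [f] by the exponential is
    log-concave and starts at [1], so that it cannot rise above [1] after having
    dropped below. *)
Lemma second_moment_le_plateau (f : R -> R) (h K s a : R) :
  nonneg_on_halfline f -> decreasing_on_halfline f ->
  log_concave_on_halfline f -> measurable_fun (`[0, +oo[ : set R) f ->
  0 < h -> 0 < K -> a <= h -> K * expR (- s * h) = f h ->
  (forall t, 0 <= t -> t <= h -> f t <= K * expR (- s * t)) ->
  (\int[mu]_(t in `[0%R, h]) (f t)%:E =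
   \int[mu]_(t in `[0%R, h]) (plateau_exp K s a t)%:E)%E ->
  (\int[mu]_(t in `]h, +oo[) (f t)%:E =
   \int[mu]_(t in `]h, +oo[) (plateau_exp K s a t)%:E)%E ->
  (\int[mu]_(t in `[0%R, h]) (plateau_exp K s a t)%:E < +oo)%E ->
  (\int[mu]_(t in `]h, +oo[) (plateau_exp K s a t)%:E < +oo)%E ->
  (second_moment f <=
   \int[mu]_(t in `[0%R, +oo[) (t ^+ 2 * plateau_exp K s a t)%:E)%E.
Proof.
move=> f0 decf lc mf h0 K0 ah Kh fK eql eqr finl finr.
have h0' := ltW h0.
pose g := plateau_exp K s a.
have g0 t : 0 <= g t by exact/plateau_exp_ge0/ltW.
have mg (D : set R) : measurable_fun D g by exact: measurable_plateau_exp.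
have mfl : measurable_fun (`[0, h] : set R) f.
  by apply: measurable_funS mf => //; apply: subset_itvl; rewrite bnd_simp.
have mfr : measurable_fun (`]h, +oo[ : set R) f.
  by apply: measurable_funS mf => //; apply: subset_itvr; rewrite bnd_simp.
have f0l t : (`[0, h]%classic : set R) t -> 0 <= f t.
  by rewrite /= in_itv/= => /andP[/f0].
have f0r t : (`]h, +oo[%classic : set R) t -> 0 <= f t.
  by rewrite /= in_itv/= andbT => ht; apply: f0; rewrite ltW// (lt_trans h0).
have compl : (\int[mu]_(t in `[0%R, h]) (t ^+ 2 * f t)%:E <=
              \int[mu]_(t in `[0%R, h]) (t ^+ 2 * g t)%:E)%E.
  apply: second_moment_le_of_crossing => //.
  - by move=> t; rewrite /= !in_itv/= => /andP[->].
  - move=> u v; rewrite /= !in_itv/= => /andP[u0 uh] /andP[v0 vh] uv gfv.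
    have va : v < a.
      rewrite ltNge; apply/negP => av; move: gfv.
      by rewrite /g plateau_expE_ge// ltNge fK.
    rewrite /g plateau_expE_le ?(ltW (lt_trans uv va))//.
    rewrite -(plateau_expE_le K s (ltW va)); apply: (le_trans (ltW gfv)).
    by rewrite decf// ltW.
have compr : (\int[mu]_(t in `]h, +oo[) (t ^+ 2 * f t)%:E <=
              \int[mu]_(t in `]h, +oo[) (t ^+ 2 * g t)%:E)%E.
  apply: second_moment_le_of_crossing => //.
  - by move=> t; rewrite /= !in_itv/= !andbT => ht; rewrite ltW// (lt_trans h0).
  - move=> u v; rewrite /= !in_itv/= !andbT => hu hv uv.
    rewrite /g !plateau_expE_ge ?(ltW (le_lt_trans ah _))// => gfv.
    by apply/ltW/(log_concave_above_exp lc K0 h0' hu uv _ gfv); rewrite Kh.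
have sq t : 0 <= t -> 0 <= t ^+ 2 * f t.
  by move=> /f0 ft; rewrite mulr_ge0 ?sqr_ge0.
rewrite /second_moment (ge0_integral_halfline_split h0' _ sq); last first.
  exact: measurable_funM.
apply: (le_trans (leeD compl compr)).
rewrite -(ge0_integral_halfline_split h0')//; last 2 first.
- exact: measurable_funM.
- by move=> t _; rewrite mulr_ge0 ?sqr_ge0.
Qed.

Lemma second_moment_bound (f : R -> R) (h : R) :
  admissible f -> 0 < h -> small_mass_upto f h ->
  (second_moment f <= (moment_bound f h)%:E)%E.
Proof.
move=> [f0 intf decf lc F0] h0 small.
set F := total_mass f in F0.
have h0' := ltW h0.
have mf : measurable_fun (`[0, +oo[ : set R) f.
  by apply/measurable_EFinP; case/integrableP: intf.
have IF : (\int[mu]_(t in `[0%R, +oo[) (f t)%:E = F%:E)%E.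
  by rewrite /F /total_mass /Rintegral fineK// integrable_fin_num.
have := ge0_integral_halfline_split h0' mf f0; rewrite IF.
have mfl : measurable_fun (`[0, h] : set R) f.
  by apply: measurable_funS mf => //; apply: subset_itvl; rewrite bnd_simp.
have f0l t : (`[0, h]%classic : set R) t -> 0 <= f t.
  by rewrite /= in_itv/= => /andP[/f0].
have f0r t : (`]h, +oo[%classic : set R) t -> 0 <= f t.
  by rewrite /= in_itv/= andbT => ht; apply: f0; rewrite ltW// (lt_trans h0).
have := integral_ge0 mu (fun t Dt => f0r t Dt : (0 <= (f t)%:E)%E).
move: (erefl (mass_upto f h)); rewrite {2}/mass_upto /Rintegral.
case IA : (\int[mu]_(t in `[0%R, h]) (f t)%:E)%E => [A| |] //=; last first.
  by case IB : (\int[mu]_(t in `]h, +oo[) (f t)%:E)%E.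
case IB : (\int[mu]_(t in `]h, +oo[) (f t)%:E)%E => [B| |] //=.
move=> massA _ [FE].
have A_small : A <= (1 - expR (- Num.sqrt 3)) * F by rewrite -massA.
have e3 : 0 < expR (- Num.sqrt 3) :> R by exact: expR_gt0.
have BF : expR (- Num.sqrt 3) * F <= B by nra.
have B0 : 0 < B by apply: lt_le_trans BF; rewrite mulr_gt0.
set m := f h.
(* Otherwise [f], being nonincreasing, vanishes beyond [h], against [0 < B]. *)
have m0 : 0 < m.
  rewrite lt_neqAle f0// andbT eq_sym; apply/eqP => m0.
  suff : (B%:E = 0)%E by move=> [] B0'; rewrite B0' ltxx in B0.
  rewrite -IB; apply: integral0_eq => t; rewrite /= in_itv/= andbT => ht.
  congr EFin; apply/le_anti; rewrite f0 ?andbT ?(ltW (lt_trans h0 ht))//.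
  by rewrite -m0 decf// ltW.
pose s := m / B.
have s0 : 0 < s by rewrite divr_gt0.
pose y := s * h.
have y0 : 0 <= y by rewrite mulr_ge0 ?ltW.
pose K := m * expR y.
have K0 : 0 <= K by rewrite mulr_ge0 ?expR_ge0 ?ltW.
have mB : m = s * B by rewrite /s divfK ?gt_eqF.
have Kh : K * expR (- s * h) = m.
  by rewrite /K -mulrA -expRD /y mulNr subrr expR0 mulr1.
have Ktail a : a <= h ->
    (\int[mu]_(t in `]h, +oo[) (plateau_exp K s a t)%:E = B%:E)%E.
  move=> ah; rewrite integral_plateau_tail// Kh; congr EFin.
  by rewrite mB; field; rewrite gt_eqF.
have fK t : 0 <= t -> t <= h -> f t <= K * expR (- s * t).
  by move=> t0 th; exact: log_concave_le_exp_left IB B0 t0 th.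
(* [f >= f h] on [[0, h]], whence [f h * h <= A]. *)
have lower : B * (1 + y) <= F.
  have : (\int[mu]_(t in `[0%R, h]) (cst m%:E) t <= A%:E)%E.
    rewrite -IA; apply: ge0_le_integral => //.
    - by move=> t _; rewrite lee_fin ltW.
    - exact/measurable_EFinP.
    - move=> t; rewrite /= in_itv/= => /andP[t0 th].
      by rewrite lee_fin decf.
  rewrite integral_cst//= lebesgue_measure_itv/= lte_fin h0 sube0 -EFinM.
  rewrite lee_fin.
  by rewrite FE /y mB; lra.
(* The pure exponential dominates [f] on [[0, h]] and has the same tail. *)
have upper : F <= B * expR y.
  have : (F%:E <= \int[mu]_(t in `[0%R, +oo[) (plateau_exp K s 0 t)%:E)%E.
    rewrite (ge0_integral_halfline_split h0'); last 2 first.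
    - exact: measurable_plateau_exp.
    - by move=> t _; exact: plateau_exp_ge0.
    rewrite Ktail// FE EFinD leeD2r// -IA.
    apply: ge0_le_integral => //.
    - exact/measurable_EFinP.
    - apply/measurable_EFinP; exact: measurable_plateau_exp.
    - move=> t; rewrite /= in_itv/= => /andP[t0 th].
      by rewrite lee_fin plateau_expE_ge ?fK.
  rewrite integral_plateau// lee_fin mulr0 expR0 /K mB => /le_trans; apply.
  by rewrite le_eqVlt; apply/orP; left; apply/eqP; field; rewrite gt_eqF.
have [||x /andP[x0 xy] xE] := @exists_plateau_length y (F / B) y0.
- by rewrite ler_pdivlMr// mulrC.
- by rewrite ler_pdivrMr// mulrC.
(* The plateau length for which the comparison function has mass [F]. *)
pose a := x / s.
have a0 : 0 <= a by rewrite divr_ge0 ?(ltW s0)//.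
have ah : a <= h by rewrite ler_pdivrMr// mulrC.
have x1 : 0 < 1 + x by rewrite ltr_pwDl.
have Ka : K * expR (- s * a) = s * F / (1 + x).
  rewrite /K -mulrA -expRD.
  have -> : y + - s * a = y - x by rewrite /a; field; rewrite gt_eqF.
  have -> : expR (y - x) = F / B / (1 + x).
    by rewrite -xE; field; rewrite gt_eqF.
  by rewrite mB; field; rewrite !gt_eqF.
pose g := plateau_exp K s a.
have g0 t : 0 <= g t by exact: plateau_exp_ge0.
have mg (D : set R) : measurable_fun D g by exact: measurable_plateau_exp.
have Ig : (\int[mu]_(t in `[0%R, +oo[) (g t)%:E = F%:E)%E.
  rewrite integral_plateau// Ka /a; congr EFin; field.
  by rewrite !gt_eqF.
have Igr := Ktail a ah; rewrite -/g in Igr.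
have Igl : (\int[mu]_(t in `[0%R, h]) (g t)%:E = A%:E)%E.
  have := ge0_integral_halfline_split h0' (mg _) (fun t _ => g0 t).
  rewrite Ig Igr FE.
  case: (\int[mu]_(t in `[0%R, h]) (g t)%:E)%E => //= r [rE].
  by congr EFin; lra.
have K1 : 0 < K by rewrite mulr_gt0 ?expR_gt0.
apply: le_trans.
  apply: (second_moment_le_plateau f0 decf lc mf h0 K1 ah Kh fK).
  - by rewrite IA Igl.
  - by rewrite IB Igr.
  - by rewrite Igl ltry.
  - by rewrite Igr ltry.
rewrite integral_sqr_plateau// lee_fin Ka /moment_bound massA -/F.
have -> : 1 - A / F = (F / B)^-1.
  have -> : A = F - B by lra.
  by field; rewrite !gt_eqF.
have FB : 0 < F / B by rewrite divr_gt0.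
rewrite lnV ?posrE// opprK.
set L := ln (F / B).
have LE : L = ln (1 + x) + y - x.
  by rewrite /L -xE lnM ?posrE ?expR_gt0// expRK addrA.
have yp : 0 < y by rewrite mulr_gt0.
have L0 : 0 < L.
  by apply: ln_gt0; rewrite ltr_pdivlMr// mul1r; apply: lt_le_trans lower; nra.
have L3 : L <= Num.sqrt 3.
  rewrite -ler_expR /L lnK ?posrE// ler_pdivrMr//.
  rewrite -ler_pdivrMl ?expR_gt0// -expRN//.
have key := moment_inequality x0 LE (ltW L0) L3.
rewrite -subr_ge0.
have -> : 2 * h ^+ 2 / L ^+ 2 * F -
   s * F / (1 + x) * (a ^+ 3 / 3 + a ^+ 2 / s + 2 * a / s ^+ 2 + 2 / s ^+ 3) =
  2 * F / (s ^+ 2 * L ^+ 2 * (1 + x)) *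
  ((1 + x) * y ^+ 2 - L ^+ 2 * (1 + x + x ^+ 2 / 2 + x ^+ 3 / 6)).
  by rewrite /a /y; field; rewrite !gt_eqF.
rewrite mulr_ge0 ?subr_ge0// divr_ge0//; first by rewrite mulr_ge0 ?ltW.
by rewrite mulr_ge0 ?(ltW x1)// mulr_ge0 ?sqr_ge0.
Qed.

(** * Exponentials attain the bound *)

Lemma exponential_equality (c lambda : R) : 0 < c -> 0 < lambda ->
  let f := fun t : R => c * expR (- lambda * t) * \1_(`[0, +oo[) t in
  admissible f /\
  (forall h : R, 0 < h -> second_moment f = (moment_bound f h)%:E).
Proof.
move=> c0 l0 f.
have fE t : 0 <= t -> f t = c * expR (- lambda * t).
  by move=> t0; rewrite /f indicE mem_set ?mulr1//= in_itv/= t0.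
have fp t : 0 <= t -> f t = plateau_exp c lambda 0 t.
  by move=> t0; rewrite fE// plateau_expE_ge.
have cl : 0 < c / lambda by rewrite divr_gt0.
have mf : measurable_fun (`[0, +oo[ : set R) f.
  apply: (eq_measurable_fun (plateau_exp c lambda 0)).
    by move=> t; rewrite inE /= in_itv/= andbT => t0; rewrite fp.
  exact: measurable_plateau_exp.
have If : (\int[mu]_(t in `[0%R, +oo[) (f t)%:E = (c / lambda)%:E)%E.
  transitivity (\int[mu]_(t in `[0%R, +oo[) (plateau_exp c lambda 0 t)%:E)%E.
    by apply: eq_integral => t; rewrite inE /= in_itv/= andbT => t0; rewrite fp.
  rewrite integral_plateau ?(ltW c0)//; congr EFin.
  by rewrite mulr0 expR0; field; rewrite gt_eqF.
have f0 t : 0 <= t -> 0 <= f t.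
  by move=> t0; rewrite fp// plateau_exp_ge0 ?ltW.
have total : total_mass f = c / lambda by rewrite /total_mass /Rintegral If.
split; first split => //.
- apply/integrableP; split; first exact/measurable_EFinP.
  rewrite [ltLHS](_ : _ = (c / lambda)%:E) ?ltry// -If.
  apply: eq_integral => t; rewrite inE /= in_itv/= andbT => t0.
  by rewrite ger0_norm ?f0.
- move=> x y x0 xy; rewrite !fE//; last exact: le_trans xy.
  by rewrite ler_pM2l// ler_expR !mulNr lerN2 ler_pM2l.
- move=> x y tau x0 y0 t0 t1.
  have xy0 : 0 <= (1 - tau) * x + tau * y.
    by rewrite addr_ge0// mulr_ge0// ?subr_ge0 ltW.
  have pos t : 0 < c * expR (- lambda * t) by rewrite mulr_gt0 ?expR_gt0.
  rewrite !fE// /powR !gt_eqF// -expRD !lnM ?posrE ?expR_gt0// !expRK.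
  rewrite -[c in leRHS](@lnK _ c) ?posrE// -expRD ler_expR.
  by rewrite le_eqVlt; apply/orP; left; apply/eqP; ring.
- by rewrite total.
move=> h h0.
have mass : mass_upto f h = c / lambda * (1 - expR (- lambda * h)).
  have tail : (\int[mu]_(t in `]h, +oo[) (f t)%:E =
      (c * expR (- lambda * h) / lambda)%:E)%E.
    rewrite -(@integral_plateau_tail c lambda 0) ?(ltW c0) ?(ltW h0)//.
    apply: eq_integral => t; rewrite inE /= in_itv/= andbT => ht.
    by rewrite fp// ltW// (lt_trans h0).
  move: (ge0_integral_halfline_split (ltW h0) mf f0).
  rewrite If tail /mass_upto /Rintegral.
  case: (\int[mu]_(t in `[0%R, h]) (f t)%:E)%E => //= r [rE].
  have -> : r = c / lambda - c * expR (- lambda * h) / lambda.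
    by rewrite rE; ring.
  by field; rewrite gt_eqF.
have -> : second_moment f = (2 * c / lambda ^+ 3)%:E.
  rewrite /second_moment.
  transitivity
      (\int[mu]_(t in `[0%R, +oo[) (t ^+ 2 * plateau_exp c lambda 0 t)%:E)%E.
    by apply: eq_integral => t; rewrite inE /= in_itv/= andbT => t0; rewrite fp.
  rewrite integral_sqr_plateau ?(ltW c0)//; congr EFin.
  by rewrite mulr0 expR0; field; rewrite gt_eqF.
rewrite /moment_bound mass total.
have -> : 1 - c / lambda * (1 - expR (- lambda * h)) / (c / lambda) =
          expR (- lambda * h) by field; rewrite !gt_eqF.
by rewrite expRK; congr EFin; field; rewrite !gt_eqF.
Qed.

End halfline.

Theorem theorem1p1 (R : realType) :
  (forall (f : R -> R) (h : R),
     admissible f -> 0 < h -> small_mass_upto f h ->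
     (second_moment f <= (moment_bound f h)%:E)%E)
  /\
  (forall c lambda : R, 0 < c -> 0 < lambda ->
     let f := fun t : R => c * expR (- lambda * t) * \1_(`[0, +oo[) t in
     admissible f /\
     (forall h : R, 0 < h -> small_mass_upto f h ->
        second_moment f = (moment_bound f h)%:E)).
Proof.
split=> [f h|c lambda c0 lambda0 f]; first exact: second_moment_bound.
have [admf eqf] := exponential_equality c0 lambda0.
by split=> // h h0 _; exact: eqf.
Qed.
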